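(* Let $X$ be a Banach space which has a $c_0$-spreading model. Then $\ell_\infty^n$ is in the $n$-th asymptotic structure of $X$ for all $n\ge1$. Consequently, for every $\varepsilon>0$, every non-trivial countably branching bundle graph, endowed with its graph distance, admits a (bi-)Lipschitz embedding into $X$ with distortion less than $6+\varepsilon$.
   Context: Spreading models. Let $(y_n)_{n\ge1}$ be a bounded non-convergent sequence in $X$ such that for all $k\ge1$ and $a_1,\dots,a_k\in\mathbb R$ the limit $\lim_{n_1<\dots<n_k}\|\sum_{i=1}^ka_iy_{n_i}\|$ (as $n_1\to\infty$ with $n_1<\dots<n_k$) exists. Then $\|\sum_{i=1}^ka_ie_i\|=\lim_{n_1<\dots<n_k}\|\sum_{i=1}^ka_iy_{n_i}\|$ defines a norm on $c_{00}$ (with canonical basis $(e_i)$), and its completion is the spreading model generated by $(y_n)$. $X$ has a $c_0$-spreading model if it has a spreading model isomorphic to $c_0$. Asymptotic structure. Let $\mathrm{cof}(X)$ be the set of closed subspaces of $X$ of finite codimension; $S_Y$ denotes the unit sphere of $Y$. An $n$-dimensional space $E$ with normalized basis $(e_i)_{i=1}^n$ is in the $n$-th asymptotic structure of $X$ if for all $\varepsilon>0$: $\forall X_1\in\mathrm{cof}(X)\ \exists x_1\in S_{X_1}\ \cdots\ \forall X_n\in\mathrm{cof}(X)\ \exists x_n\in S_{X_n}$: $(x_i)_{i=1}^n$ is $(1+\varepsilon)$-equivalent to $(e_i)_{i=1}^n$. Here $(x_i)$ is $C$-equivalent to $(e_i)$ if there are $A,B>0$ with $AB\le C$ and $\frac1A\|\sum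 a_ie_i\|\le\|\sum a_ix_i\|\le B\|\sum a_ie_i\|$ for all scalars $a_i$. $\ell_\infty^n$ is taken with its unit vector basis. Bundle graphs. A top-bottom graph is a graph with two distinguished vertices, one designated as the top and the other as the bottom. A countably branching bundle graph is a top-bottom graph that can be formed, starting from a path of length $1$, by a finite sequence of the following operations: (i) given two countably branching bundle graphs, identify the top of one with the bottom of the other, the bottom of the first being the new bottom and the top of the second the new top; (ii) take countably infinitely many copies of a countably branching bundle graph and identify all the bottoms with each other and all the tops with each other. It is non-trivial if it is obtained by such a sequence with at least one operation (ii). A map $f:(M,d)\to X$ has distortion at most $D$ if there is $s>0$ with $s\,d(x,y)\le\|f(x)-f(y)\|\le sD\,d(x,y)$ for all $x,y\in M$. *)

(* Defs.v *)
From mathcomp Require Import all_boot all_order all_algebra.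
From mathcomp Require Import all_classical all_reals all_analysis.

Set Implicit Arguments.
Unset Strict Implicit.
Unset Printing Implicit Defensive.

Import Order.TTheory GRing.Theory Num.Theory.
Import numFieldNormedType.Exports.

Local Open Scope classical_set_scope.
Local Open Scope ring_scope.

(** * Spreading models *)

(* The filter of the limit "n_1 -> oo with n_1 < ... < n_k". *)
Definition spread_filter (k : nat) : set_system ('I_k -> nat) :=
  filter_from setT (fun N : nat =>
    [set n : 'I_k -> nat |
      {homo n : i j / (i < j)%N} /\ (forall i, (N <= n i)%N)]).

Arguments spread_filter : clear implicits.

(* [Z], with the images [e i] of the canonical basis of c_00, is a completion
   of c_00 for the norm given by the limits of the |\sum_i a_i y_(n_i)|: the
   map a |-> \sum_i a_i e_i is isometric on c_00 and has dense range in the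
   complete space [Z]. *)
Definition spreading_model (R : realType) (X : completeNormedModType R)
    (y : nat -> X) (Z : completeNormedModType R) (e : nat -> Z) : Prop :=
  [/\ bounded_fun y,
      ~ cvg (y @ \oo),
      forall (k : nat) (a : 'I_k -> R),
        (fun n : 'I_k -> nat => `|\sum_(i < k) a i *: y (n i)|)
          @ spread_filter k --> `|\sum_(i < k) a i *: e i|
    & dense [set z : Z | exists (k : nat) (a : 'I_k -> R),
                           z = \sum_(i < k) a i *: e i]].

Definition c0 (R : realType) : set (nat -> R) := [set u | u @ \oo --> (0 : R)].

Definition sup_norm (R : realType) (u : nat -> R) : R :=
  sup (range (fun n => `|u n|)).

Definition isomorphic_to_c0 (R : realType) (Z : normedModType R) : Prop :=
  exists T : {linear Z -> (nat -> R^o)},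
    range T = @c0 R /\
    exists A B : R, [/\ 0 < A, 0 < B &
      forall z, A * `|z| <= sup_norm (T z) <= B * `|z|].

Definition has_c0_spreading_model (R : realType)
    (X : completeNormedModType R) : Prop :=
  exists (y : nat -> X) (Z : completeNormedModType R) (e : nat -> Z),
    spreading_model y e /\ isomorphic_to_c0 Z.

(** * Asymptotic structure *)

Definition is_subspace (R : realType) (X : normedModType R) (Y : set X) :=
  Y 0 /\ forall (a : R) (u v : X), Y u -> Y v -> Y (a *: u + v).

(* X / Y is spanned by finitely many classes. *)
Definition finite_codim (R : realType) (X : normedModType R) (Y : set X) :=
  exists (m : nat) (v : 'I_m -> X), forall x : X,
    exists2 y, Y y & exists c : 'I_m -> R, x = y + \sum_(i < m) c i *: v i.

Definition cof (R : realType) (X : normedModType R) : set (set X) :=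
  [set Y | [/\ is_subspace Y, closed Y & finite_codim Y]].

Definition equivalent (R : realType) (n : nat) (X E : normedModType R)
    (C : R) (x : 'I_n -> X) (e : 'I_n -> E) : Prop :=
  exists A B : R, [/\ 0 < A, 0 < B, A * B <= C &
    forall a : 'I_n -> R,
      A^-1 * `|\sum_(i < n) a i *: e i| <= `|\sum_(i < n) a i *: x i|
        <= B * `|\sum_(i < n) a i *: e i|].

(* forall X_1, exists x_1 in S_(X_1), ..., forall X_n, exists x_n in S_(X_n),
   P [:: x_1; ...; x_n] *)
Fixpoint asymptotic_game (R : realType) (X : normedModType R) (n : nat)
    (P : seq X -> Prop) : Prop :=
  if n is m.+1 then
    forall Y, cof Y -> exists x : X,
      [/\ Y x, `|x| = 1 & asymptotic_game m (fun s => P (x :: s))]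
  else P [::].

Definition normalized_basis (R : realType) (n : nat) (E : normedModType R)
    (e : 'I_n -> E) : Prop :=
  (forall i, `|e i| = 1) /\
  (forall v : E, exists! a : 'I_n -> R, v = \sum_(i < n) a i *: e i).

Definition in_asymptotic_structure (R : realType) (X : normedModType R)
    (n : nat) (E : normedModType R) (e : 'I_n -> E) : Prop :=
  normalized_basis e /\
  forall eps : R, 0 < eps ->
    asymptotic_game n (fun s : seq X =>
      equivalent (1 + eps) (fun i : 'I_n => nth 0 s i) e).

(* The norm of 'rV[R]_n is the maximum of the absolute values of the entries,
   so that 'rV[R]_n is l_oo^n. *)
Definition linf_basis (R : realType) (n : nat) (i : 'I_n) : 'rV[R]_n :=
  delta_mx 0 i.

(** * Bundle graphs *)

Record tbgraph := TBGraph {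
  vertex :> Type;
  adj : vertex -> vertex -> Prop;
  adj_sym : forall x y, adj x y -> adj y x;
  adj_irr : forall x, ~ adj x x;
  top : vertex;
  bot : vertex }.

Arguments adj {t} _ _.
Arguments top {t}.
Arguments bot {t}.

(* The graphs are described up to isomorphism: instead of forming quotients,
   the gluings are characterized by the maps of the pieces into the result. *)

Definition path1 (G : tbgraph) : Prop :=
  [/\ @top G <> bot,
      forall x : G, x = top \/ x = bot
    & @adj G top bot].

Definition series_comp (G1 G2 G : tbgraph) : Prop :=
  exists (i1 : G1 -> G) (i2 : G2 -> G),
    [/\ injective i1 /\ injective i2,
        forall x y, i1 x = i2 y <-> x = top /\ y = bot,
        forall z, (exists x, z = i1 x) \/ (exists y, z = i2 y),
        forall z z', adj z z' <->
          (exists x x', [/\ adj x x', z = i1 x & z' = i1 x']) \/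
          (exists y y', [/\ adj y y', z = i2 y & z' = i2 y'])
      & bot = i1 bot /\ top = i2 top].

Definition parallel_copies (H G : tbgraph) : Prop :=
  exists j : nat -> H -> G,
    [/\ forall k l x y, j k x = j l y <->
          [\/ k = l /\ x = y, x = top /\ y = top | x = bot /\ y = bot],
        forall z, exists k x, z = j k x,
        forall z z', adj z z' <->
          exists k x x', [/\ adj x x', z = j k x & z' = j k x']
      & forall k, bot = j k bot /\ top = j k top].

(* The boolean records whether [parallel_copies] has been used. *)
Inductive bundle_graph : bool -> tbgraph -> Prop :=
| bundle_path1 G : path1 G -> bundle_graph false G
| bundle_series b1 b2 G1 G2 G :
    bundle_graph b1 G1 -> bundle_graph b2 G2 -> series_comp G1 G2 G ->
    bundle_graph (b1 || b2) G
| bundle_parallel b H G :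
    bundle_graph b H -> parallel_copies H G -> bundle_graph true G.

Definition nontrivial_bundle_graph (G : tbgraph) : Prop := bundle_graph true G.

Fixpoint walk (G : tbgraph) (n : nat) (x y : G) : Prop :=
  if n is m.+1 then exists2 z, adj x z & walk m z y else x = y.

Definition graph_dist (G : tbgraph) (x y : G) : nat :=
  xget 0%N [set n | walk n x y /\ forall m, walk m x y -> (n <= m)%N].

Definition distortion_at_most (R : realType) (G : tbgraph)
    (X : normedModType R) (f : G -> X) (D : R) : Prop :=
  exists2 s : R, 0 < s & forall x y : G,
    s * (graph_dist x y)%:R <= `|f x - f y| <= s * D * (graph_dist x y)%:R.

(* Main.v *)
Require Import Defs.
From mathcomp Require Import all_boot all_order all_algebra.
From mathcomp Require Import all_classical all_reals all_analysis.
From mathcomp Require Import zify ring lra.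

(** The fundamental sequence (e_i) of the spreading model is spreading: the norm of
    a_1 e_(n_1) + ... + a_k e_(n_k) does not depend on n_1 < ... < n_k.  Its
    consecutive differences are nonzero, because (y_n) does not converge, and they
    admit an upper c0 estimate [norm_pairs_bounded].  The latter is a gliding
    hump argument: by compactness, the indices can be spread out so that the
    differences, seen in c0, are nearly disjointly supported, and this does not
    change norms.

    The constants are then improved to 1 as in James' theorem that c0 is not
    distortable [near_linf_blocks].  Let L be the supremum of the norms of the
    combinations of the differences with coefficients in [-1, 1], and let u be
    a combination whose norm nearly attains L.  Consecutive copies u_j of u
    satisfy |sum_j b_j u_j| <= L max |b_j| by the choice of L.  They also
    satisfy |b_j| |u| <= |sum_j b_j u_j|, because the other blocks can be
    shifted to the right and averaged away: their coefficients sum to 0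
    [block_suppression].

    A finite net of coefficients carries this over to X: far enough, all
    blocks sum_i c_i y_(n_i) of the original sequence, for fixed coefficients
    c_i of sum 0, are equivalent to the basis of l_oo^n with constants
    1 - delta and 1 + delta [near_linf_sequence].

    For the asymptotic structure, given a subspace of finite codimension, the
    sequence has a subsequence that is almost constant modulo this subspace
    [almost_const_mod_subspace].  As the c_i sum to 0, a block along that
    subsequence is almost in the subspace, and moving it there is a winning
    answer in the game [asymptotic_game_linf].

    For the bundle graphs, it suffices to embed them into the space of finitely
    supported sequences with the supremum norm, with a bound on the number of
    nonzero coordinates of all points, because blocks of (y_n) with disjoint
    ranges reproduce that norm on supports of bounded size.  The coordinates are
    the height of a point above the bottom and, for each copy occurring in a
    parallel composition, the distance to the nearer end of that copy
    [graph_coords].  They are 1-Lipschitz, and the distance of two points is at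
    most 3 times the largest difference of their coordinates; with delta = 1/4
    this gives distortion at most 5. *)

Set Implicit Arguments.
Unset Strict Implicit.
Unset Printing Implicit Defensive.

(** * Sparse coordinates on bundle graphs *)

Lemma walk_cat (G : tbgraph) m n (x y z : G) :
  walk m x y -> walk n y z -> walk (m + n) x z.
Proof.
elim: m x => [|m IH] x /= => [->//|[w xw wy] yz].
by exists w => //; exact: IH.
Qed.

Lemma walk_sym (G : tbgraph) n (x y : G) : walk n x y -> walk n y x.
Proof.
elim: n x => [//|n IH] x /= [w xw /IH wy].
suff : walk (n + 1) y x by rewrite addn1.
by apply: walk_cat wy _; exists x => //; exact: adj_sym.
Qed.

Lemma walk_map (G H : tbgraph) (j : G -> H) n x y :
  (forall x y, adj x y -> adj (j x) (j y)) -> walk n x y -> walk n (j x) (j y).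
Proof.
move=> jadj; elim: n x => [|n IH] x /= => [->//|[w xw wy]].
by exists (j w); [exact: jadj|exact: IH].
Qed.

Definition ndist (a b : nat) := (a - b + (b - a))%N.

(** A map of the graph into finitely supported sequences with the supremum norm,
    given by [level] and the [coordinate]s.  It is 1-Lipschitz on edges, supports
    have size at most [supp] apart from [level], and [coord_walk] bounds the
    distance of two points by 3 times the distance of their images.  The
    coordinates vanish at both ends, so that pieces can be glued by taking
    disjoint unions of their index sets, while the levels of stacked pieces add
    up. *)
Record graph_coords (G : tbgraph) := GraphCoords {
  cidx : countType;
  height : nat;
  supp : nat;
  level : G -> nat;
  coordinate : G -> cidx -> nat;
  level_bot : level bot = 0%N;
  level_top : level top = height;
  level_le x : (level x <= height)%N;
  level_adj x y : adj x y -> (ndist (level x) (level y) <= 1)%N;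
  walk_bot x : walk (level x) x bot;
  walk_top x : walk (height - level x) x top;
  coord_bot i : coordinate bot i = 0%N;
  coord_top i : coordinate top i = 0%N;
  coord_adj x y i : adj x y -> (ndist (coordinate x i) (coordinate y i) <= 1)%N;
  coord_supp x : exists2 s : seq cidx, (size s <= supp)%N &
    forall i, i \notin s -> coordinate x i = 0%N;
  coord_walk x y : exists2 m, walk m x y &
    (m <= 3 * ndist (level x) (level y))%N \/
    exists i, (m <= 3 * ndist (coordinate x i) (coordinate y i))%N }.

Lemma path1_coords G : path1 G -> inhabited (graph_coords G).
Proof.
move=> [tb all2 tb_adj].
have bt_adj := adj_sym tb_adj.
pose l (x : G) : nat := if pselect (x = top) then 1%N else 0%N.
have lt : l top = 1%N by rewrite /l; case: pselect.
have lb : l bot = 0%N by rewrite /l; case: pselect => // bt; case: tb.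
constructor.
apply: (@GraphCoords G void 1 0 l (fun _ _ => 0%N)) => //.
- by move=> x; case: (all2 x) => ->; rewrite ?lt ?lb.
- by move=> x y; case: (all2 x) (all2 y) => -> [] -> //; rewrite ?lt ?lb.
- by move=> x; case: (all2 x) => ->; rewrite ?lt ?lb //; exists bot.
- by move=> x; case: (all2 x) => ->; rewrite ?lt ?lb //; exists top.
- by move=> x; exists [::].
move=> x y; exists (ndist (l x) (l y)); last by left; lia.
by case: (all2 x) (all2 y) => -> [] ->; rewrite ?lt ?lb //=; eexists; eauto.
Qed.

Section Series.
Variables (G1 G2 G : tbgraph) (i1 : G1 -> G) (i2 : G2 -> G).
Hypothesis i1_inj : injective i1.
Hypothesis i2_inj : injective i2.
Hypothesis i12 : forall x y, i1 x = i2 y <-> x = top /\ y = bot.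
Hypothesis i_surj : forall z, (exists x, z = i1 x) \/ (exists y, z = i2 y).

Lemma glue_series (T : Type) (f1 : G1 -> T) (f2 : G2 -> T) :
  f1 top = f2 bot ->
  exists2 f : G -> T, (forall x, f (i1 x) = f1 x) & forall y, f (i2 y) = f2 y.
Proof.
move=> f12.
have /choice[f fP] : forall z, exists t,
    (forall x, z = i1 x -> t = f1 x) /\ (forall y, z = i2 y -> t = f2 y).
  move=> z; case: (i_surj z) => -[x ->].
    exists (f1 x); split=> [x' /i1_inj -> //|y /i12[-> ->]//].
  by exists (f2 x); split=> [x' /esym/i12[-> ->]//|y /i2_inj ->].
by exists f => x; [exact: (fP _).1|exact: (fP _).2].
Qed.
End Series.

Section Parallel.
Variables (H G : tbgraph) (j : nat -> H -> G).
Hypothesis j_eq : forall k l x y, j k x = j l y <->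
  [\/ k = l /\ x = y, x = top /\ y = top | x = bot /\ y = bot].
Hypothesis j_surj : forall z, exists k x, z = j k x.

Lemma glue_parallel (T : Type) (g : nat -> H -> T) :
  (forall k l, g k top = g l top) -> (forall k l, g k bot = g l bot) ->
  exists f : G -> T, forall k x, f (j k x) = g k x.
Proof.
move=> gt gb.
have /choice[f fP] : forall z, exists t, forall k x, z = j k x -> t = g k x.
  move=> z; case: (j_surj z) => k [x ->].
  by exists (g k x) => l y /j_eq [[-> ->]|[-> ->]|[-> ->]].
by exists f => k x; exact: fP.
Qed.
End Parallel.

(** Two points in different pieces are joined by a walk through the common vertex,
    whose length is the difference of their levels. *)
Lemma series_coords G1 G2 G : series_comp G1 G2 G ->
  graph_coords G1 -> graph_coords G2 -> inhabited (graph_coords G).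
Proof.
move=> [i1 [i2 [[i1_inj i2_inj] i12 i_surj G_adj [Gbot Gtop]]]] c1 c2.
have i1_adj x y : adj x y -> adj (i1 x) (i1 y).
  by move=> xy; apply/G_adj; left; exists x, y.
have i2_adj x y : adj x y -> adj (i2 x) (i2 y).
  by move=> xy; apply/G_adj; right; exists x, y.
have mid : i1 top = i2 bot by apply/i12.
have [l l1 l2] := glue_series i1_inj i2_inj i12 i_surj
  (f1 := @level _ c1) (f2 := fun y => height c1 + level c2 y)
  (etrans (level_top c1) (esym (etrans (congr1 _ (level_bot c2)) (addn0 _)))).
pose F1 x (i : cidx c1 + cidx c2) := if i is inl i then coordinate x i else 0%N.
pose F2 y (i : cidx c1 + cidx c2) := if i is inr i then coordinate y i else 0%N.
have [|F F1E F2E] := glue_series i1_inj i2_inj i12 i_surj (f1 := F1) (f2 := F2).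
  by apply/funext => -[] i /=; rewrite ?coord_top ?coord_bot.
have w12 x y : walk (height c1 - level c1 x + level c2 y) (i1 x) (i2 y).
  apply: (@walk_cat _ _ _ _ (i1 top)).
    by apply: walk_map => //; exact: walk_top.
  by rewrite mid; apply: walk_sym; apply: walk_map => //; exact: walk_bot.
constructor.
apply: (@GraphCoords G (cidx c1 + cidx c2)%type
   (height c1 + height c2) (supp c1 + supp c2) l F).
- by rewrite Gbot l1 level_bot.
- by rewrite Gtop l2 level_top.
- move=> z; case: (i_surj z) => -[x ->]; rewrite ?l1 ?l2.
    by have := level_le c1 x; lia.
  by have := level_le c2 x; lia.
- move=> z z' /G_adj[] [x [x' [xx' -> ->]]]; rewrite ?l1 ?l2.
    exact: level_adj.
  by have := level_adj c2 xx'; rewrite /ndist; lia.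
- move=> z; case: (i_surj z) => -[x ->]; rewrite ?l1 ?l2 Gbot.
    by apply: walk_map => //; exact: walk_bot.
  rewrite addnC; apply: (@walk_cat _ _ _ _ (i1 top)).
    by rewrite mid; apply: walk_map => //; exact: walk_bot.
  by rewrite -(level_top c1); apply: walk_map => //; exact: walk_bot.
- move=> z; case: (i_surj z) => -[x ->]; rewrite ?l1 ?l2 Gtop; last first.
    by rewrite subnDl; apply: walk_map => //; exact: walk_top.
  rewrite -(level_top c2) addnC -addnBA ?level_le // addnC; exact: w12.
- by rewrite Gbot => i; rewrite F1E; case: i => //= i; exact: coord_bot.
- by rewrite Gtop => i; rewrite F2E; case: i => //= i; exact: coord_top.
- move=> z z' i /G_adj[] [x [x' [xx' -> ->]]]; rewrite ?F1E ?F2E; case: i => //= i;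
    exact: coord_adj.
- move=> z; case: (i_surj z) => -[x ->].
    have [s ss s0] := coord_supp c1 x.
    exists (map inl s) => [|i]; first by rewrite size_map (leq_trans ss)// leq_addr.
    rewrite F1E; case: i => //= i iNs; apply: s0; apply: contra iNs.
    by move=> i_s; apply/mapP; exists i.
  have [s ss s0] := coord_supp c2 x.
  exists (map inr s) => [|i]; first by rewrite size_map (leq_trans ss)// leq_addl.
  rewrite F2E; case: i => //= i iNs; apply: s0; apply: contra iNs.
  by move=> i_s; apply/mapP; exists i.
move=> z z'; case: (i_surj z) (i_surj z') => -[x ->] [] [y ->].
- have [m xy mP] := coord_walk c1 x y.
  exists m; first exact: walk_map.
  rewrite !l1 !F1E; case: mP => [?|[i ?]]; [by left|right; by exists (inl i)].
- exists (height c1 - level c1 x + level c2 y)%N; first exact: w12.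
  by left; rewrite l1 l2 /ndist; have := level_le c1 x; lia.
- exists (height c1 - level c1 y + level c2 x)%N; first exact/walk_sym/w12.
  by left; rewrite l1 l2 /ndist; have := level_le c1 y; lia.
have [m xy mP] := coord_walk c2 x y.
exists m; first exact: walk_map.
rewrite !l2 !F2E; case: mP => [mP|[i ?]]; [left|right; by exists (inr i)].
by move: mP; rewrite /ndist; lia.
Qed.

(** Each copy gets one new coordinate, min(l, h - l), which is the distance to its
    two ends at level [l].  Let [x] and [y] be in different copies, at distances
    [a] and [b] from the ends.  If they are nearest to the same end, they are
    joined by a walk of length [a + b <= 2 max(a, b)] through it; otherwise the
    shorter of the two walks has length [h - |a - b|], whereas the levels differ
    by [h - a - b], so that its length is at most |l - l'| + 2 min(a, b). *)
Lemma parallel_coords H G : parallel_copies H G ->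
  graph_coords H -> inhabited (graph_coords G).
Proof.
move=> [j [j_eq j_surj G_adj j_ends]] c.
have Gbot k : bot = j k bot by case: (j_ends k).
have Gtop k : top = j k top by case: (j_ends k).
have j_adj k x y : adj x y -> adj (j k x) (j k y).
  by move=> xy; apply/G_adj; exists k, x, y.
have [l lE] := glue_parallel j_eq j_surj (g := fun _ => level c)
  (fun _ _ => erefl) (fun _ _ => erefl).
pose h := height c.
pose g k x (i : nat * option (cidx c)) := if i.1 == k then
  if i.2 is Some i' then coordinate x i' else minn (level c x) (h - level c x) else 0%N.
have gt k i : g k top i = 0%N.
  rewrite /g; case: ifP => // _; case: i.2 => [a|]; first exact: coord_top.
  by rewrite level_top subnn minn0.
have gb k i : g k bot i = 0%N.
  rewrite /g; case: ifP => // _; case: i.2 => [a|]; first exact: coord_bot.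
  by rewrite level_bot min0n.
have [||F FE] := glue_parallel j_eq j_surj (g := g).
- by move=> k k'; apply/funext => i; rewrite !gt.
- by move=> k k'; apply/funext => i; rewrite !gb.
constructor.
apply: (@GraphCoords G (nat * option (cidx c))%type h (supp c).+1 l F).
- by rewrite (Gbot 0%N) lE level_bot.
- by rewrite (Gtop 0%N) lE level_top.
- by move=> z; case: (j_surj z) => k [x ->]; rewrite lE level_le.
- by move=> z z' /G_adj[k [x [x' [xx' -> ->]]]]; rewrite !lE; exact: level_adj.
- move=> z; case: (j_surj z) => k [x ->]; rewrite lE (Gbot k).
  by apply: walk_map; [exact: j_adj|exact: walk_bot].
- move=> z; case: (j_surj z) => k [x ->]; rewrite lE (Gtop k).
  by apply: walk_map; [exact: j_adj|exact: walk_top].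
- by move=> i; rewrite (Gbot 0%N) FE gb.
- by move=> i; rewrite (Gtop 0%N) FE gt.
- move=> z z' i /G_adj[k [x [x' [xx' -> ->]]]]; rewrite !FE /g.
  case: ifP => // _; case: i.2 => [a|]; first exact: coord_adj.
  have := level_adj c xx'; have := level_le c x; have := level_le c x'.
  by rewrite /ndist /h; lia.
- move=> z; case: (j_surj z) => k [x ->].
  have [s ss s0] := coord_supp c x.
  exists ((k, None) :: [seq (k, Some i) | i <- s]); first by rewrite /= size_map.
  move=> [k' i]; rewrite FE /g /=; case: eqP => // ->.
  rewrite inE negb_or; case: i => [i|] /andP[]; last by rewrite eqxx.
  move=> _ iNs; apply: s0; apply: contra iNs => i_s.
  by apply/mapP; exists i.
move=> z z'; case: (j_surj z) (j_surj z') => k [x ->] [k' [y ->]].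
have [<-|kk'] := eqVneq k k'.
  have [m xy mP] := coord_walk c x y.
  exists m; first by apply: walk_map xy; exact: j_adj.
  rewrite !lE !FE; case: mP => [?|[i ?]]; [by left|right].
  by exists (k, Some i); rewrite /g /= eqxx.
have wbot : walk (level c x + level c y) (j k x) (j k' y).
  apply: (@walk_cat _ _ _ _ bot); [rewrite (Gbot k)|apply: walk_sym; rewrite (Gbot k')];
  apply: walk_map; [exact: j_adj|exact: walk_bot|exact: j_adj|exact: walk_bot].
have wtop : walk (h - level c x + (h - level c y)) (j k x) (j k' y).
  apply: (@walk_cat _ _ _ _ top); [rewrite (Gtop k)|apply: walk_sym; rewrite (Gtop k')];
  apply: walk_map; [exact: j_adj|exact: walk_top|exact: j_adj|exact: walk_top].
have Fk : ndist (F (j k x) (k, None)) (F (j k' y) (k, None)) =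
    minn (level c x) (h - level c x).
  by rewrite !FE /g /= eqxx (negPf kk') /ndist; lia.
have Fk' : ndist (F (j k x) (k', None)) (F (j k' y) (k', None)) =
    minn (level c y) (h - level c y).
  by rewrite !FE /g /= eqxx eq_sym (negPf kk') /ndist; lia.
have Lxy : ndist (l (j k x)) (l (j k' y)) = ndist (level c x) (level c y).
  by rewrite !lE.
have := level_le c x; have := level_le c y; rewrite -/h => hy hx.
pose m := minn (level c x + level c y) (h - level c x + (h - level c y)).
have wm : walk m (j k x) (j k' y).
  by rewrite /m; case: leqP.
exists m => //.
have [mL|mL] := leqP m (3 * ndist (level c x) (level c y)); first by left; rewrite Lxy.
have [mx|mx] := leqP m (3 * minn (level c x) (h - level c x)).
  by right; exists (k, None); rewrite Fk.
right; exists (k', None); rewrite Fk'.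
by move: mL mx; rewrite /m /ndist; lia.
Qed.

Lemma bundle_coords b G : bundle_graph b G -> inhabited (graph_coords G).
Proof.
elim=> {b G} [G|b1 b2 G1 G2 G _ [c1] _ [c2] G12|b H G _ [c] HG].
- exact: path1_coords.
- exact: series_coords G12 c1 c2.
- exact: parallel_coords HG c.
Qed.

Lemma graph_distP (G : tbgraph) (x y : G) m : walk m x y ->
  walk (graph_dist x y) x y /\ (graph_dist x y <= m)%N.
Proof.
move=> xy; rewrite /graph_dist.
case: xgetP => [n -> [xyn nmin]|/= none]; first by split=> //; exact: nmin.
pose P n := `[< walk n x y >].
have exP : exists n, P n by exists m; apply/asboolP.
case: (ex_minnP exP) => n /asboolP wn nmin.
case: (none n); split=> // k wk; apply: nmin; exact/asboolP.
Qed.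

Lemma walk_lip (G : tbgraph) (g : G -> nat) n x y :
  (forall x y, adj x y -> (ndist (g x) (g y) <= 1)%N) ->
  walk n x y -> (ndist (g x) (g y) <= n)%N.
Proof.
move=> gadj; elim: n x => [|n IH] x /= => [->|[w /gadj xw /IH]].
  by rewrite /ndist subnn.
by move: xw; rewrite /ndist; lia.
Qed.

Import Order.TTheory GRing.Theory Num.Theory.
Import numFieldNormedType.Exports.

Local Open Scope ring_scope.

(** * Subsequences and blocks *)

Definition strict_incr (phi : nat -> nat) := {homo phi : i j / (i < j)%N}.

Lemma strict_incr_ge phi : strict_incr phi -> forall i, (i <= phi i)%N.
Proof.
move=> phiS; elim=> // i IH; apply: leq_ltn_trans IH _; exact: phiS.
Qed.

Lemma strict_incr_comp phi psi :
  strict_incr phi -> strict_incr psi -> strict_incr (phi \o psi).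
Proof. by move=> phiS psiS i j ij; apply/phiS/psiS. Qed.

Lemma strict_incr_addl p : strict_incr (addn p).
Proof. by move=> i j; rewrite ltn_add2l. Qed.

(** The jump by [phi m] in the argument of [psi] keeps the values increasing
    and above every [phi i] with [i < m], since [psi k >= k]. *)
Definition splice (m : nat) (phi psi : nat -> nat) (i : nat) :=
  if (i < m)%N then phi i else psi (phi m + (i - m))%N.

Lemma splice_incr m phi psi :
  strict_incr phi -> strict_incr psi -> strict_incr (splice m phi psi).
Proof.
move=> phiS psiS i j ij; rewrite /splice.
case: (ltnP i m) => im; case: (ltnP j m) => jm.
- exact: phiS.
- apply: leq_trans (phiS _ _ im) _.
  by apply: leq_trans (leq_addr _ _) _; exact: strict_incr_ge.
- lia.
- by apply: psiS; lia.
Qed.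

Lemma sum_blocks (V : nmodType) n M (F : nat -> V) :
  \sum_(l < n * M) F l = \sum_(j < n) \sum_(i < M) F (j * M + i)%N.
Proof.
elim: n => [|n IH]; first by rewrite mul0n !big_ord0.
by rewrite mulSnr big_split_ord /= IH big_ord_recr.
Qed.

Lemma flatten_blocks (R : pzRingType) (V : lmodType R) n M (b c : nat -> R)
    (v : nat -> V) :
  \sum_(j < n) b j *: \sum_(i < M) c i *: v (j * M + i)%N =
  \sum_(l < n * M) (b (l %/ M)%N * c (l %% M)%N) *: v l.
Proof.
rewrite (sum_blocks n M (fun l => (b (l %/ M)%N * c (l %% M)%N) *: v l)).
apply: eq_bigr => j _; rewrite scaler_sumr; apply: eq_bigr => i _.
have M0 : (0 < M)%N by apply: leq_ltn_trans (ltn_ord i).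
by rewrite scalerA divnMDl// divn_small// addn0 modnMDl modn_small.
Qed.

(** The coefficients a_0, - a_0, a_1, - a_1, and so on. *)
Definition pair_coef (R : zmodType) (a : nat -> R) l :=
  if odd l then - a l./2 else a l./2.

Lemma sum_pairs (R : pzRingType) (V : lmodType R) k (a : nat -> R)
    (v : nat -> V) :
  \sum_(i < k) a i *: (v i.*2 - v i.*2.+1) =
  \sum_(l < k.*2) pair_coef a l *: v l.
Proof.
elim: k => [|k IH]; first by rewrite !big_ord0.
rewrite doubleS 3!big_ord_recr /= IH /pair_coef /= odd_double /=.
by rewrite uphalf_double doubleK scalerBr scaleNr addrA.
Qed.

(** * Almost constant subsequences and null sequences *)

Section RealSeq.
Variable R : realType.

Lemma real_almost_const (D : R) (s : nat -> R) (eta : R) : 0 < eta ->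
  (forall i, `|s i| <= D) ->
  exists2 psi, strict_incr psi &
    forall i j, `|s (psi i) - s (psi j)| <= eta.
Proof.
move=> eta0 sD.
have bs : bounded_fun s.
  exists D; split; first exact/ger0_real/(le_trans (normr_ge0 (s 0%N))).
  by move=> x /ltW Dx i _; apply: le_trans Dx.
have [f fI /cvg_ex [l fl]] := bolzano_weierstrass bs.
have fS : strict_incr f by move=> i j; rewrite !ltnNge -!leEnat fI.
have eta20 : 0 < eta / 2 by lra.
have /cvgrPdist_le /(_ _ eta20)[N _ lN] := fl.
exists (f \o addn N) => [|i j /=].
  exact/strict_incr_comp/strict_incr_addl.
have := lN (N + i)%N (leq_addr _ _); have := lN (N + j)%N (leq_addr _ _) => /=.
move=> li lj.
have -> : s (f (N + i)%N) - s (f (N + j)%N) =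
  (l - s (f (N + j)%N)) - (l - s (f (N + i)%N)) by ring.
by apply: le_trans (ler_normB _ _) _; lra.
Qed.

(** Extract successively along the coordinates. *)
Lemma coords_almost_const (D : R) (t : nat -> nat -> R) (eta : R) N : 0 < eta ->
  (forall i n, `|t i n| <= D) ->
  exists2 psi, strict_incr psi &
    forall i j n, (n < N)%N -> `|t (psi i) n - t (psi j) n| <= eta.
Proof.
move=> eta0 tD; elim: N => [|N [psi psiS psiP]]; first by exists id.
have [chi chiS chiP] := real_almost_const eta0 (fun i => tD (psi i) N).
exists (psi \o chi) => [|i j n]; first exact: strict_incr_comp.
by rewrite ltnS leq_eqVlt => /orP[/eqP->|nN]; [exact: chiP|exact: psiP].
Qed.

Lemma c0_bounded (u : nat -> R) : c0 u -> exists C, forall n, `|u n| <= C.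
Proof.
move=> u0; have : cvgn u by apply/cvg_ex; exists 0.
move=> /cvg_seq_bounded [C [_ /(_ (C + 1))]].
rewrite ltrDl => /(_ ltr01) uC.
by exists (C + 1) => n; exact: uC.
Qed.

Lemma le_sup_norm (u : nat -> R) n : c0 u -> `|u n| <= sup_norm u.
Proof.
move=> /c0_bounded[C uC]; apply: ub_le_sup; last by exists n.
by exists C => _ [m _ <-].
Qed.

Lemma sup_norm_le (u : nat -> R) C : (forall n, `|u n| <= C) -> sup_norm u <= C.
Proof.
by move=> uC; apply: ge_sup; [exists `|u 0%N|, 0%N|move=> _ [m _ <-]].
Qed.

Lemma c0_small (k : nat) (g : nat -> nat -> R) (eta : R) : 0 < eta ->
  (forall i, c0 (g i)) ->
  exists N, forall n, (N <= n)%N -> \sum_(i < k) `|g i n| <= eta.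
Proof.
move=> eta0 gc0; elim: k eta eta0 => [|k IH] eta eta0.
  by exists 0%N => n _; rewrite big_ord0 ltW.
have eta20 : 0 < eta / 2 by lra.
have [N1 N1P] := IH _ eta20.
have /cvgrPdist_le /(_ _ eta20)[N2 _ N2P] := gc0 k.
exists (maxn N1 N2) => n; rewrite geq_max => /andP[n1 n2].
rewrite big_ord_recr /=; have := N1P _ n1.
by have := N2P n n2; rewrite /= sub0r normrN; lra.
Qed.
End RealSeq.

(** * Spreading sequences *)

(** The norm that [e] gives to a linear combination is the limit of the norms of
    the same combination along far subsequences of [y]. *)
Definition spreads_as (R : realType) (X Z : normedModType R)
    (y : nat -> X) (e : nat -> Z) :=
  forall k (a : nat -> R) (eta : R), 0 < eta ->
  exists N, forall phi, strict_incr phi -> (forall i, N <= phi i)%N ->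
    `| `|\sum_(i < k) a i *: y (phi i)| - `|\sum_(i < k) a i *: e i| | <= eta.

Section Spreading.
Variables (R : realType) (X Z : normedModType R) (y : nat -> X) (e : nat -> Z).
Hypothesis spreadP : spreads_as y e.

(** Both sides are limits of the norms of the same vectors of [X], because a
    combination of the [e (phi i)] is also one of e_0, e_1, ... with zeros
    inserted in the coefficients. *)
Lemma spreading k (a : nat -> R) phi : strict_incr phi ->
  `|\sum_(i < k) a i *: e (phi i)| = `|\sum_(i < k) a i *: e i|.
Proof.
move=> phiS.
pose a' l := \sum_(i < k | phi i == l) a i.
have sumE (V : lmodType R) (v : nat -> V) :
    \sum_(l < phi k) a' l *: v l = \sum_(i < k) a i *: v (phi i).
  under eq_bigr => l _ do rewrite /a' scaler_suml big_mkcond /=.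
  rewrite exchange_big /=; apply: eq_bigr => i _.
  rewrite -big_mkcond /=.
  have lt : (phi i < phi k)%N by exact: phiS.
  rewrite (big_pred1 (Ordinal lt))//.
apply/eqP; rewrite -subr_eq0 -normr_eq0 eq_le normr_ge0 andbT.
apply/ler_addgt0Pl => eta eta0.
have eta20 : 0 < eta / 2 by lra.
have [N1 N1P] := spreadP k a eta20.
have [N2 N2P] := spreadP (phi k) a' eta20.
have sS := @strict_incr_addl (N1 + N2).
have h1 := N1P _ (strict_incr_comp sS phiS) (fun i => ltac:(rewrite /=; lia)).
have h2 := N2P _ sS (fun i => ltac:(rewrite /=; lia)).
rewrite sumE (sumE _ (fun l => y (N1 + N2 + l)%N)) /= in h1 h2.
set p := `|\sum_(i < k) a i *: y _| in h1 h2.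
rewrite addr0.
have -> : forall u v : R, u - v = (p - v) - (p - u) by move=> u v; ring.
by apply: le_trans (ler_normB _ _) _; lra.
Qed.

Lemma norm_spread p : `|e p| = `|e 0%N|.
Proof.
have := spreading 1 (fun=> 1) (@strict_incr_addl p).
by rewrite !big_ord_recl !big_ord0 !addr0 !scale1r /= addn0.
Qed.

(** The bound does not depend on [K]: the sums of [e] over two windows of length
    [K] at distance [i] differ by at most [2 i] terms, and the coefficients sum
    to 0, so that each window can be compared with the first one. *)
Lemma norm_shift_average (c : nat -> R) M p K : \sum_(i < M) c i = 0 ->
  `|\sum_(i < M) c i *: \sum_(r < K) e (p + i + r)%N| <=
  \sum_(i < M) `|c i| * (2 * i%:R * `|e 0%N|).
Proof.
move=> c_sum; pose S i := \sum_(r < K) e (p + i + r)%N.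
have SB i : `|S i - S 0%N| <= 2 * i%:R * `|e 0%N|.
  elim: i => [|i IH]; first by rewrite subrr normr0 mulr0 mul0r.
  have -> : S i.+1 - S 0%N = (e (p + i + K)%N - e (p + i)%N) + (S i - S 0%N).
    rewrite addrA; congr (_ - _); rewrite /S.
    apply: (addrI (e (p + i)%N)); rewrite addrA subrKC.
    have -> : e (p + i)%N + \sum_(r < K) e (p + i.+1 + r)%N =
        \sum_(r < K.+1) e (p + i + r)%N.
      rewrite big_ord_recl addn0; congr (_ + _); apply: eq_bigr => r _.
      by congr e; rewrite /= /bump; lia.
    by rewrite big_ord_recr addrC.
  apply: le_trans (ler_normD _ _) _.
  have := ler_normB (e (p + i + K)%N) (e (p + i)%N); rewrite !norm_spread.
  by rewrite -natr1; lra.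
have -> : \sum_(i < M) c i *: S i = \sum_(i < M) c i *: (S i - S 0%N).
  under [RHS]eq_bigr do rewrite scalerBr.
  by rewrite sumrB -scaler_suml c_sum scale0r subr0.
apply: le_trans (ler_norm_sum _ _ _) _; apply: ler_sum => i _.
by rewrite normrZ ler_wpM2l.
Qed.

(** Blocks of length [M] are pulled apart by gaps of length [K], and all blocks
    but the [j0]-th one are moved by [r] within their gaps. *)
Definition block_shift M K j0 r l :=
  (l %/ M * (M + K) + l %% M + (if l %/ M == j0 then 0 else r))%N.

Lemma block_shift_incr M K j0 r : (0 < M)%N -> (r <= K)%N ->
  strict_incr (block_shift M K j0 r).
Proof.
move=> M0 rK l l' ll'; rewrite /block_shift.
have := ltn_pmod l M0; have := ltn_pmod l' M0; have := divn_eq l M.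
have := divn_eq l' M; have := leq_div2r M (ltnW ll').
move: (l %/ M)%N (l' %/ M)%N (l %% M)%N (l' %% M)%N => q q' s s'.
rewrite leq_eqVlt => /orP[/eqP->|qq'] El' El s'M sM; first by lia.
have : ((q.+1 * (M + K)) <= q' * (M + K))%N by rewrite leq_mul2r qq' orbT.
by rewrite mulSnr; case: ifP; case: ifP; lia.
Qed.

(** Moving all blocks but the [j0]-th one by [r] does not change the norm.  In
    the average over [r < K], the moving blocks contribute a vector of norm
    O(1 / K) by [norm_shift_average], and only the [j0]-th block remains. *)
Lemma block_suppression (c : nat -> R) M n (b : nat -> R) j0 :
  \sum_(i < M) c i = 0 -> (j0 < n)%N ->
  `|b j0| * `|\sum_(i < M) c i *: e i| <=
  `|\sum_(j < n) b j *: \sum_(i < M) c i *: e (j * M + i)%N|.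
Proof.
move=> c_sum j0n; have [->|M0] := posnP M; first by rewrite big_ord0 normr0 mulr0.
set U := `|\sum_(j < n) _|.
pose Er := \sum_(i < M) `|c i| * (2 * i%:R * `|e 0%N|).
pose B := \sum_(j < n) `|b j|.
have Er0 : 0 <= Er by apply: sumr_ge0 => i _; rewrite !mulr_ge0.
have B0 : 0 <= B by apply: sumr_ge0.
have key K : `|b j0| * `|\sum_(i < M) c i *: e i| *+ K <= U *+ K + B * Er.
  pose J0 := Ordinal j0n.
  pose V r := \sum_(j < n) b j *: \sum_(i < M) c i *:
    e (j * (M + K) + i + (if j == J0 then 0 else r))%N.
  have VU r : (r < K)%N -> `|V r| = U.
    move=> rK; have bS := block_shift_incr j0 M0 (ltnW rK).
    rewrite /U flatten_blocks.
    rewrite -(spreading _ (fun l => b (l %/ M)%N * c (l %% M)%N) bS).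
    rewrite -(flatten_blocks n M b c (e \o block_shift M K j0 r)) /=.
    congr `|_|.
    apply: eq_bigr => j _; congr (_ *: _); apply: eq_bigr => i _.
    by rewrite /block_shift divnMDl// divn_small// addn0 modnMDl modn_small.
  pose w := \sum_(i < M) c i *: e (j0 * (M + K) + i)%N.
  have wE : `|\sum_(i < M) c i *: e i| = `|w|.
    by rewrite -(spreading _ c (@strict_incr_addl (j0 * (M + K)))).
  have sumV : \sum_(r < K) V r = b j0 *: w *+ K + \sum_(j < n | j != J0) b j *:
      \sum_(i < M) c i *: \sum_(r < K) e (j * (M + K) + i + r)%N.
    rewrite exchange_big /= (bigD1 J0) //=; congr (_ + _).
      under eq_bigr => r _ do under eq_bigr => i _ do rewrite eqxx addn0.
      by rewrite sumr_const card_ord.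
    apply: eq_bigr => j /negPf jJ; rewrite -scaler_sumr exchange_big /= jJ.
    by congr (_ *: _); apply: eq_bigr => i _; rewrite scaler_sumr.
  have -> : `|b j0| * `|\sum_(i < M) c i *: e i| *+ K = `|b j0 *: w *+ K|.
    by rewrite wE normrMn normrZ.
  have -> : b j0 *: w *+ K = \sum_(r < K) V r - \sum_(j < n | j != J0) b j *:
      \sum_(i < M) c i *: \sum_(r < K) e (j * (M + K) + i + r)%N.
    by rewrite sumV addrK.
  apply: le_trans (ler_normB _ _) _; apply: lerD.
    apply: le_trans (ler_norm_sum _ _ _) _.
    under eq_bigr => r _ do rewrite VU//.
    by rewrite sumr_const card_ord.
  apply: le_trans (ler_norm_sum _ _ _) _; rewrite big_mkcond mulr_suml.
  apply: ler_sum => j _; case: ifP => _; last by rewrite mulr_ge0.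
  by rewrite normrZ ler_wpM2l// norm_shift_average.
apply/ler_addgt0Pl => eta eta0.
have BEr0 : 0 <= B * Er by rewrite mulr_ge0.
pose K := (Num.truncn (B * Er / eta)).+1.
have KP : B * Er < eta *+ K.
  by rewrite -mulr_natl -ltr_pdivrMr// truncnS_gt.
rewrite -(ler_pMn2r (isT : (0 < K)%N)).
by apply: le_trans (key K) _; rewrite mulrnDl addrC lerD2r ltW.
Qed.
End Spreading.

(** * Blocks of a sequence spreading in c0 *)

Lemma norm_blocks_le (R : realType) (V : normedModType R) n M (b c : nat -> R)
    (v : nat -> V) (D : R) : (forall l, `|v l| <= D) ->
  `|\sum_(j < n) b j *: \sum_(i < M) c i *: v (j * M + i)%N| <=
  (\sum_(j < n) `|b j|) * ((\sum_(i < M) `|c i|) * D).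
Proof.
move=> vD; apply: le_trans (ler_norm_sum _ _ _) _; rewrite mulr_suml.
apply: ler_sum => j _; rewrite normrZ ler_wpM2l//.
apply: le_trans (ler_norm_sum _ _ _) _; rewrite mulr_suml.
by apply: ler_sum => i _; rewrite normrZ ler_wpM2l.
Qed.

(** The blocks of [y] with coefficients [c] along far increasing indices are
    equivalent to the basis of l_oo^n with constants 1 - delta and 1 + delta.  The
    maximum of the |b_j| is named by an index [j0] where it is attained. *)
Definition far_blocks_near_linf (R : realType) (X : normedModType R)
    (y : nat -> X) n (delta : R) M (c : nat -> R) N : Prop :=
  forall phi, strict_incr phi -> (forall i, N <= phi i)%N ->
  forall (b : nat -> R) j0, (j0 < n)%N ->
    (forall j, (j < n)%N -> `|b j| <= `|b j0|) ->
    (1 - delta) * `|b j0| <=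
    `|\sum_(j < n) b j *: \sum_(i < M) c i *: y (phi (j * M + i)%N)|
    <= (1 + delta) * `|b j0|.

Section SpreadingC0.
Variables (R : realType) (X Z : normedModType R) (y : nat -> X) (e : nat -> Z).
Hypothesis spreadP : spreads_as y e.
Hypothesis Z_c0 : isomorphic_to_c0 Z.
Hypothesis e01 : e 0%N != e 1%N.

Definition pairs (a : nat -> R) k := \sum_(i < k) a i *: (e i.*2 - e i.*2.+1).

(** Gliding hump.  Indices are chosen so that, in c0, each new difference is
    small on the coordinates where the previous ones are not, so that every
    coordinate sees at most one large difference. *)
Lemma norm_pairs_bounded : exists C, forall k (a : nat -> R),
  (forall i, (i < k)%N -> `|a i| <= 1) -> `|pairs a k| <= C.
Proof.
have [T [rT [A [B [A0 B0 TP]]]]] := Z_c0.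
have Tc0 z : c0 (T z) by rewrite -rT; exists z.
have TleB z n : `|T z n| <= B * `|z|.
  by apply: le_trans (le_sup_norm n (Tc0 z)) _; case/andP: (TP z).
pose M := B * (2 * `|e 0%N|).
have M0 : 0 <= M by rewrite !mulr_ge0// ltW.
have TM p q n : `|T (e p - e q) n| <= M.
  apply: le_trans (TleB _ _) _; rewrite ler_pM2l//.
  by apply: le_trans (ler_normB _ _) _; rewrite !(norm_spread spreadP); lra.
have TeB p n : `|T (e p) n| <= B * `|e 0%N| by rewrite -(norm_spread spreadP p).
have TB p q n : T (e p - e q) n = T (e p) n - T (e q) n by rewrite linearB.
(* [M] bounds a single difference; each further one costs only [eta]. *)
have hump k eta : 0 < eta -> exists2 phi, strict_incr phi & forall n,
    \sum_(i < k) `|T (e (phi i.*2) - e (phi i.*2.+1)) n| <= M + k%:R * eta.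
  move=> eta0; elim: k => [|k [phi phiS phiP]].
    by exists id => // n; rewrite big_ord0 mul0r addr0.
  have [N NP] := c0_small k eta0
    (fun i => Tc0 (e (phi i.*2) - e (phi i.*2.+1))).
  (* Beyond [N] the differences chosen so far add up to at most [eta]; the next
     difference has to be small before [N]. *)
  have [psi psiS psiP] := coords_almost_const N eta0 TeB.
  exists (splice k.*2 phi psi) => [|n]; first exact: splice_incr.
  have lo i : (i < k.*2)%N -> splice k.*2 phi psi i = phi i.
    by rewrite /splice => ->.
  have hi i : (k.*2 <= i)%N ->
      splice k.*2 phi psi i = psi (phi k.*2 + (i - k.*2))%N.
    by rewrite /splice ltnNge => ->.
  rewrite big_ord_recr /= !hi//.
  under eq_bigr => i _ do rewrite !lo ?ltn_Sdouble ?ltn_double//.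
  rewrite -natr1; have [nN|Nn] := ltnP n N.
    have := phiP n; rewrite [X in _ + `|X|]TB.
    have := psiP (phi k.*2 + (k.*2 - k.*2))%N
                 (phi k.*2 + (k.*2.+1 - k.*2))%N n nN.
    by rewrite mulrDl mul1r; lra.
  have := NP n Nn; set s := \sum_(i < k) _ => sN.
  have := TM (psi (phi k.*2 + (k.*2 - k.*2))%N)
             (psi (phi k.*2 + (k.*2.+1 - k.*2))%N) n.
  have : 0 <= k%:R * eta by rewrite mulr_ge0 ?ler0n ?ltW.
  by rewrite mulrDl mul1r; lra.
exists (A^-1 * (M + 1)) => k a a1.
have k0 : 0 < (k%:R + 1 : R)^-1 by rewrite invr_gt0 ltr_wpDl.
have [phi phiS phiP] := hump k _ k0.
rewrite /pairs (sum_pairs k a e) -(spreading spreadP _ _ phiS).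
rewrite -(sum_pairs k a (e \o phi)) /=.
set z := \sum_(i < k) _; rewrite ler_pdivlMl//.
have /andP[Az _] := TP z; apply: le_trans Az _; apply: sup_norm_le => n.
have -> : T z n = \sum_(i < k) a i * T (e (phi i.*2) - e (phi i.*2.+1)) n.
  rewrite /z linear_sum fct_sumE; apply: eq_bigr => i _.
  by rewrite linearZ.
apply: le_trans (ler_norm_sum _ _ _) _.
have le1 : k%:R * (k%:R + 1)^-1 <= 1 :> R.
  by rewrite ler_pdivrMr ?ltr_wpDl// mul1r lerDl.
apply: le_trans (le_trans (phiP n) _); last by rewrite lerD2l.
by apply: ler_sum => i _; rewrite normrM ler_piMl// a1.
Qed.

(** James' argument: [L] is the supremum of the norms of the combinations of
    differences with coefficients bounded by 1, and [c] is a normalized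
    combination whose norm is almost [L].  Combinations of copies of it are again
    admissible for [L], which gives the upper bound; the lower bound is
    [block_suppression]. *)
Lemma near_linf_blocks (delta : R) : 0 < delta ->
  exists M (c : nat -> R), \sum_(i < M) c i = 0 /\
    forall n (b : nat -> R) (beta : R), 0 <= beta ->
      (forall j, (j < n)%N -> `|b j| <= beta) ->
      let u := \sum_(j < n) b j *: \sum_(i < M) c i *: e (j * M + i)%N in
      `|u| <= (1 + delta) * beta /\ forall j, (j < n)%N -> `|b j| <= `|u|.
Proof.
move=> delta0; have [C CP] := norm_pairs_bounded.
pose S : set R := [set r | exists k a,
  (forall i, (i < k)%N -> `|a i| <= 1) /\ r = `|pairs a k|]%classic.
have SC : ubound S C by move=> _ [k [a [a1 ->]]]; exact: CP.
pose L := sup S.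
have leL k a : (forall i, (i < k)%N -> `|a i| <= 1) -> `|pairs a k| <= L.
  by move=> a1; apply: ub_le_sup; [exists C|exists k, a].
have L0 : 0 < L.
  have /(leL 1%N): forall i, (i < 1)%N -> `|(fun=> 1 : R) i| <= 1.
    by move=> *; rewrite normr1.
  apply: lt_le_trans; rewrite /pairs big_ord1 scale1r normr_gt0 subr_eq0.
  exact: e01.
have hS : has_sup S.
  by split; [exists `|pairs (fun=> 0) 0|, 0%N, (fun=> 0)|exists C].
have gap : 0 < L - L / (1 + delta).
  by rewrite subr_gt0 ltr_pdivrMr ?addr_gt0// ltr_pMr// ltrDl.
have [w [k [a [a1 wE]]]] := sup_adherent gap hS.
rewrite -/L opprB addrCA subrr addr0 => Lw.
have w0 : 0 < w by apply: lt_trans Lw; rewrite divr_gt0// addr_gt0.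
exists k.*2, (fun l => w^-1 * pair_coef a l).
have sum0 : \sum_(i < k.*2) w^-1 * pair_coef a i = 0.
  rewrite -mulr_sumr; have := sum_pairs k a (fun=> 1 : R^o).
  under eq_bigr => i _ do rewrite subrr scaler0.
  rewrite big1_eq; under eq_bigr => i _ do rewrite /GRing.scale /= mulr1.
  by move=> <-; rewrite mulr0.
split=> // n b beta beta0 bP u; split; last first.
  move=> j jn.
  have := block_suppression (c := fun l => w^-1 * pair_coef a l) spreadP b sum0 jn.
  suff -> : `|\sum_(i < k.*2) (w^-1 * pair_coef a i) *: e i| = 1 by rewrite mulr1.
  under eq_bigr => i _ do rewrite -scalerA.
  rewrite -scaler_sumr -(sum_pairs k a e) normrZ -/(pairs a k) -wE.
  by rewrite gtr0_norm ?invr_gt0// mulVf// gt_eqF.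
have -> : u = w^-1 *: pairs (fun l => b (l %/ k)%N * a (l %% k)%N) (n * k).
  rewrite /pairs -(flatten_blocks n k b a (fun l => e l.*2 - e l.*2.+1)).
  rewrite scaler_sumr; apply: eq_bigr => j _.
  rewrite scalerA mulrC -scalerA; congr (_ *: _).
  have -> : \sum_(i < k) a i *:
      (e (j * k + i)%N.*2 - e (j * k + i)%N.*2.+1) =
      \sum_(i < k.*2) pair_coef a i *: e (j * k.*2 + i)%N.
    rewrite -(sum_pairs k a (fun l => e (j * k.*2 + l)%N)).
    by apply: eq_bigr => i _; rewrite doubleD doubleMr addnS.
  by rewrite scaler_sumr; apply: eq_bigr => i _; rewrite scalerA.
rewrite normrZ gtr0_norm ?invr_gt0//.
have : `|pairs (fun l => b (l %/ k)%N * a (l %% k)%N) (n * k)| <= L * beta.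
  have ba l : (l < n * k)%N -> `|b (l %/ k)%N * a (l %% k)%N| <= beta.
    have [->|k0] := posnP k; first by rewrite muln0.
    move=> lnk; rewrite normrM -[beta]mulr1 ler_pM// ?a1 ?ltn_pmod//.
    by apply: bP; rewrite ltn_divLR.
  move: beta0; rewrite le_eqVlt => /orP[/eqP b0|b0].
    rewrite -b0 mulr0 /pairs big1 ?normr0// => l _.
    have := ba l (ltn_ord l); rewrite -b0 normr_le0 => /eqP ->.
    by rewrite scale0r.
  have -> : pairs (fun l => b (l %/ k)%N * a (l %% k)%N) (n * k) =
      beta *: pairs (fun l => beta^-1 * (b (l %/ k)%N * a (l %% k)%N)) (n * k).
    rewrite /pairs scaler_sumr; apply: eq_bigr => l _.
    by rewrite scalerA mulVKf// gt_eqF.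
  rewrite normrZ gtr0_norm// mulrC ler_pM2r//; apply: leL => l lnk.
  by rewrite normrM gtr0_norm ?invr_gt0// ler_pdivrMl// mulr1 ba.
move=> h; rewrite ler_pdivrMl//; apply: le_trans h _.
rewrite mulrA ler_wpM2r// ltW//.
by rewrite -ltr_pdivrMr ?addr_gt0.
Qed.

(** For each single [b], the estimates of [near_linf_blocks] pass from [e] to far
    blocks of [y].  Both norms are Lipschitz in [b], so it suffices to treat the
    finitely many [b] on a fine grid of [-1, 1]^n, which makes [N] uniform. *)
Lemma near_linf_sequence (D : R) n (delta : R) : 0 < delta ->
  (forall l, `|y l| <= D) ->
  exists M (c : nat -> R) N, \sum_(i < M) c i = 0 /\ far_blocks_near_linf y n delta M c N.
Proof.
move=> delta0 yD.
have d40 : 0 < delta / 4 by lra.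
have [M [c [c_sum cP]]] := near_linf_blocks d40.
pose CD := (\sum_(i < M) `|c i|) * D.
have CD0 : 0 <= CD.
  by rewrite mulr_ge0 ?sumr_ge0// (le_trans _ (yD 0%N)).
pose K := (Num.truncn ((n%:R * CD + 1) / (delta / 4))).+1.
have K0 : 0 < K%:R :> R by rewrite ltr0n.
have KP : (n%:R * CD + 1) / K%:R <= delta / 4.
  by rewrite ler_pdivrMr// [leRHS]mulrC -ler_pdivrMr// ltW// truncnS_gt.
have nCDK : n%:R * CD / K%:R <= delta / 4.
  by apply: le_trans KP; rewrite ler_pM2r ?invr_gt0// lerDl.
have K1 : K%:R^-1 <= delta / 4.
  apply: le_trans KP; rewrite -[leLHS]mul1r ler_pM2r ?invr_gt0// lerDr.
  by rewrite mulr_ge0.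
pose grid (g : {ffun 'I_n.+1 -> 'I_(K.*2.+1)}) j : R :=
  ((g (inord j))%:R - K%:R) / K%:R.
have grid1 g j : `|grid g j| <= 1.
  rewrite /grid normrM [`|_^-1|]gtr0_norm ?invr_gt0// ler_pdivrMr// mul1r.
  rewrite ler_norml.
  have gK : (g (inord j))%:R <= K%:R + K%:R :> R.
    by rewrite -natrD ler_nat addnn -ltnS ltn_ord.
  have : 0 <= (g (inord j))%:R :> R by [].
  by move: gK; lra.
have /choice[N_ N_P] : forall g, exists N, forall phi, strict_incr phi ->
    (forall i, N <= phi i)%N ->
  `| `|\sum_(l < n * M) (grid g (l %/ M)%N * c (l %% M)%N) *: y (phi l)| -
     `|\sum_(l < n * M) (grid g (l %/ M)%N * c (l %% M)%N) *: e l| | <= delta / 4.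
  move=> g.
  exact: (spreadP (n * M) (fun l => grid g (l %/ M)%N * c (l %% M)%N) d40).
exists M, c, (\max_g N_ g); split=> // phi phiS phiN b j0 j0n bmax.
pose V (b : nat -> R) :=
  \sum_(j < n) b j *: \sum_(i < M) c i *: y (phi (j * M + i)%N).
rewrite -/(V b).
have [b0|b0] := eqVneq (b j0) 0.
  rewrite b0 normr0 !mulr0 /V big1 ?normr0 ?lexx// => j _.
  have := bmax j (ltn_ord j); rewrite b0 normr0 normr_le0 => /eqP ->.
  by rewrite scale0r.
have nb0 : 0 < `|b j0| by rewrite normr_gt0.
pose b1 j := b j / b j0.
have -> : V b = b j0 *: V b1.
  rewrite /V scaler_sumr; apply: eq_bigr => j _.
  by rewrite scalerA /b1 mulrC divfK.
rewrite normrZ [`|b j0| * _]mulrC !ler_pM2r//.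
have b1j0 : b1 j0 = 1 by rewrite /b1 divff.
have b1P j : (j < n)%N -> `|b1 j| <= 1.
  by move=> jn; rewrite /b1 normrM normfV ler_pdivrMr// mul1r bmax.
have x0 j : (j < n)%N -> 0 <= (b1 j + 1) * K%:R.
  move=> /b1P; rewrite ler_norml => /andP[l1 _].
  by rewrite mulr_ge0 ?ler0n//; lra.
have ordP j : (j < n)%N -> (Num.truncn ((b1 j + 1) * K%:R) < K.*2.+1)%N.
  move=> jn; rewrite truncn_lt_nat ?x0// -natr1 -addnn natrD.
  have := b1P j jn; rewrite ler_norml => /andP[_ l2].
  have : 0 <= (1 - b1 j) * K%:R by rewrite mulr_ge0//; lra.
  by rewrite mulrBl mulrDl; lra.
pose g : {ffun 'I_n.+1 -> 'I_(K.*2.+1)} :=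
  [ffun i => inord (Num.truncn ((b1 (val i) + 1) * K%:R))].
have gP j : (j < n)%N -> `|b1 j - grid g j| <= K%:R^-1.
  move=> jn; have jn1 : (j < n.+1)%N by exact: leqW.
  rewrite /grid ffunE /= (inordK jn1) inordK ?ordP//.
  have := truncn_itv (x0 j jn); rewrite -natr1.
  set t := (Num.truncn _)%:R => /andP[t1 t2].
  have -> : b1 j - (t - K%:R) / K%:R = ((b1 j + 1) * K%:R - t) / K%:R.
    by field; rewrite gt_eqF.
  rewrite normrM [`|_^-1|]gtr0_norm ?invr_gt0// -[leRHS]mul1r.
  by rewrite ler_pM2r ?invr_gt0// ger0_norm; lra.
have VB : `|V b1 - V (grid g)| <= delta / 4.
  have -> : V b1 - V (grid g) =
      \sum_(j < n) (b1 j - grid g j) *: \sum_(i < M) c i *: y (phi (j * M + i)%N).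
    by rewrite /V -sumrB; apply: eq_bigr => j _; rewrite scalerBl.
  apply: le_trans (norm_blocks_le n M (fun j => b1 j - grid g j) c
    (v := fun l => y (phi l)) (fun l => yD (phi l))) _.
  rewrite -/CD; apply: le_trans nCDK; rewrite mulrAC ler_wpM2r//.
  apply: le_trans (_ : \sum_(j < n) K%:R^-1 <= _).
    by apply: ler_sum => j _; exact: gP.
  by rewrite sumr_const card_ord -[leLHS]mulr_natl.
have := N_P g phi phiS (fun i => leq_trans (leq_bigmax g) (phiN i)).
rewrite -(flatten_blocks n M (grid g) c (y \o phi)).
rewrite -(flatten_blocks n M (grid g) c e) /= -/(V (grid g)).
have [] := cP n (grid g) 1 ler01 (fun j _ => grid1 g j).
rewrite mulr1; set W := `|\sum_(j < n) _| => Wle /(_ j0 j0n) Wge.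
have g1 : 1 - delta / 4 <= `|grid g j0|.
  have := gP j0 j0n; rewrite b1j0 => h.
  have := ler_normD (1 - grid g j0) (grid g j0); rewrite subrK normr1; lra.
rewrite ler_norml => /andP[VW1 VW2].
have := ler_normD (V b1 - V (grid g)) (V (grid g)).
have := ler_normB (V b1) (V b1 - V (grid g)).
rewrite subrK opprB addrC subrK => N1 N2.
by apply/andP; split; lra.
Qed.
End SpreadingC0.

Section Model.
Variables (R : realType) (X : completeNormedModType R) (y : nat -> X).
Variables (Z : completeNormedModType R) (e : nat -> Z).
Hypothesis ye : spreading_model y e.

Lemma spreading_model_spreads : spreads_as y e.
Proof.
case: ye => _ _ lim _ k a eta eta0.
have [N _ NP] := lim k (fun i => a i) _ (nbhsx_ballx _ _ eta0).
exists N => phi phiS phiN; rewrite distrC; apply: ltW.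
by apply: (NP (fun i => phi i)); split => // i j; exact: phiS.
Qed.

Lemma spreading_model_bounded : exists D, forall l, `|y l| <= D.
Proof.
case: ye => -[D [_ /(_ (D + 1))]] + _ _ _; rewrite ltrDl => /(_ ltr01) yD.
by exists (D + 1) => l; exact: yD.
Qed.

(** If e_0 = e_1, then |y_m - y_n| tends to 0 for m < n, so that (y_n) is a
    Cauchy sequence. *)
Lemma spreading_model_neq : e 0%N != e 1%N.
Proof.
case: (ye) => _ ncvg _ _; apply/eqP => e01; apply: ncvg.
apply/cauchy_cvgP/cauchy_exP => eps eps0.
have eps20 : 0 < eps / 2 by lra.
pose a i : R := if i == 0%N then 1 else - 1.
have [N NP] := spreading_model_spreads 2 a eps20.
exists (y N); exists N => // m /= Nm; rewrite -ball_normE /=.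
move: Nm; rewrite leq_eqVlt => /orP[/eqP->|Nm]; first by rewrite subrr normr0.
pose phi i := if i == 0%N then N else (m + i)%N.-1.
have phiS : strict_incr phi.
  by move=> [|i] [|j] //; rewrite /phi /=; lia.
have phiN i : (N <= phi i)%N by rewrite /phi; case: i => [|i] /=; lia.
have := NP phi phiS phiN; rewrite !big_ord_recl !big_ord0 /a /phi /= /bump /=.
rewrite !addn0 !addr0 !scale1r !scaleN1r e01 subrr normr0 subr0 normr_id.
by rewrite addn1 /=; lra.
Qed.
End Model.


(** * Asymptotic structure *)

Section Subspace.
Variables (R : realType) (X : normedModType R).
Implicit Types Y : set X.

Lemma subspaceD Y u v : is_subspace Y -> Y u -> Y v -> Y (u + v).
Proof. by move=> [_ YP] Yu Yv; have := YP 1 u v Yu Yv; rewrite scale1r. Qed.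

Lemma subspaceZ Y a u : is_subspace Y -> Y u -> Y (a *: u).
Proof. by move=> [Y0 YP] Yu; have := YP a u 0 Yu Y0; rewrite addr0. Qed.

Lemma subspaceN Y u : is_subspace Y -> Y u -> Y (- u).
Proof. by rewrite -scaleN1r; exact: subspaceZ. Qed.

Lemma subspace_sum Y k (c : nat -> R) (w : nat -> X) : is_subspace Y ->
  (forall i, Y (w i)) -> Y (\sum_(i < k) c i *: w i).
Proof.
move=> YS Yw; elim: k => [|k IH]; first by rewrite big_ord0; case: YS.
by rewrite big_ord_recr; apply: subspaceD => //; exact: subspaceZ.
Qed.

(** Induction on the number of vectors [v] spanning [X] modulo [Y]: the subsequence
    is first extracted modulo [Y + R v0].  If [v0] is in the closure of [Y],
    nothing more is needed.  Otherwise [v0] is at positive distance from [Y], so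
    that the coefficients of [v0] are bounded, and they are almost constant along
    a further subsequence. *)
Lemma almost_const_mod_subspace Y (D eta : R) (s : nat -> X) :
  is_subspace Y -> finite_codim Y -> 0 < eta -> (forall i, `|s i| <= D) ->
  exists2 psi, strict_incr psi & forall i j,
    exists2 w, Y w & `|s (psi i) - s (psi j) - w| <= eta.
Proof.
move=> YS [m [v vP]] eta0 sD.
elim: m v Y eta YS eta0 vP => [|m IH] v Y eta YS eta0 vP.
  exists id => // i j; exists (s i - s j); last by rewrite subrr normr0 ltW.
  by have [w Yw [c ->]] := vP (s i - s j); rewrite big_ord0 addr0.
pose v0 := v ord_max.
pose Y1 : set X := [set x | exists2 w, Y w & exists t, x = w + t *: v0]%classic.
have Y1S : is_subspace Y1.
  split; first by exists 0; [case: YS|exists 0; rewrite scale0r addr0].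
  move=> a _ _ [w Yw [t ->]] [w' Yw' [t' ->]].
  exists (a *: w + w'); first by case: YS => _; apply.
  by exists (a * t + t'); rewrite scalerDr scalerDl scalerA addrACA.
have Y1P x : exists2 w, Y1 w &
    exists c : 'I_m -> R, x = w + \sum_(i < m) c i *: v (widen_ord (leqnSn m) i).
  have [w Yw [c ->]] := vP x.
  exists (w + c ord_max *: v0); first by exists w => //; exists (c ord_max).
  exists (fun i => c (widen_ord (leqnSn m) i)).
  by rewrite big_ord_recr /= -addrA [_ *: v0 + _]addrC.
have eta40 : 0 < eta / 4 by lra.
have [psi psiS psiP] := IH _ _ _ Y1S eta40 Y1P.
have [v0Y|] := pselect (forall r, 0 < r -> exists2 w, Y w & `|v0 - w| <= r).
  exists psi => // i j; have [_ [w Yw [t ->]] wP] := psiP i j.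
  have r0 : 0 < eta / 2 / (`|t| + 1) by rewrite !divr_gt0// ltr_wpDl.
  have [w' Yw' w'P] := v0Y _ r0.
  exists (w + t *: w').
    by apply: subspaceD => //; exact: subspaceZ.
  have -> : s (psi i) - s (psi j) - (w + t *: w') =
      (s (psi i) - s (psi j) - (w + t *: v0)) + t *: (v0 - w').
    rewrite scalerBr !opprD !addrA; congr (_ - _).
    by rewrite -[RHS]addrA addNr addr0.
  apply: le_trans (ler_normD _ _) _; rewrite normrZ.
  have : `|t| * `|v0 - w'| <= eta / 2.
    move: w'P; rewrite ler_pdivlMr ?ltr_wpDl// => w'P.
    by apply: le_trans w'P; rewrite mulrC ler_wpM2l// lerDl.
  by lra.
move=> /existsNP[rho /not_implyP[rho0 rhoP]].
have far t w : Y w -> `|t| * rho <= `|w + t *: v0|.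
  move=> Yw; have [->|t0] := eqVneq t 0; first by rewrite normr0 mul0r.
  have -> : w + t *: v0 = t *: (v0 - (- t^-1) *: w).
    by rewrite scalerBr scalerA mulrN divff// scaleN1r opprK addrC.
  rewrite normrZ ler_wpM2l// leNgt; apply/negP => /ltW h; apply: rhoP.
  by exists ((- t^-1) *: w) => //; exact: subspaceZ.
have /choice[wt wtP] : forall i, exists p : X * R,
    Y p.1 /\ `|s (psi i) - s (psi 0%N) - (p.1 + p.2 *: v0)| <= eta / 4.
  by move=> i; have [_ [w Yw [t ->]] wP] := psiP i 0%N; exists (w, t).
have tB i : `|(wt i).2| <= (2 * D + eta / 4) / rho.
  have [Yw wP] := wtP i; rewrite ler_pdivlMr//; apply: le_trans (far _ _ Yw) _.
  set z := (wt i).1 + (wt i).2 *: v0 in wP *.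
  have -> : z = (s (psi i) - s (psi 0%N)) - (s (psi i) - s (psi 0%N) - z).
    by rewrite opprB addrC subrK.
  apply: le_trans (ler_normB _ _) _; apply: lerD => //.
  apply: le_trans (ler_normB _ _) _.
  by have := sD (psi i); have := sD (psi 0%N); lra.
have eta2 : 0 < eta / 2 / (`|v0| + 1) by rewrite !divr_gt0// ltr_wpDl.
have [chi chiS chiP] := real_almost_const eta2 tB.
exists (psi \o chi) => [|i j /=]; first exact: strict_incr_comp.
exists ((wt (chi i)).1 - (wt (chi j)).1).
  apply: subspaceD => //; first exact: (wtP _).1.
  by apply: subspaceN => //; exact: (wtP _).1.
have [_ ] := wtP (chi i); have [_] := wtP (chi j); have := chiP i j.
set ti := (wt (chi i)).2; set tj := (wt (chi j)).2.
set wi := (wt (chi i)).1; set wj := (wt (chi j)).1.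
set si := s (psi (chi i)); set sj := s (psi (chi j)); set s0 := s _ => tij Ej Ei.
have -> : si - sj - (wi - wj) =
    (si - s0 - (wi + ti *: v0)) - (sj - s0 - (wj + tj *: v0)) + (ti - tj) *: v0.
  have subDD (a b c d : X) : (a + b) - (c + d) = (a - c) + (b - d).
    by rewrite opprD addrACA.
  have cancel (a b c : X) : a - (b + c) + c = a - b.
    by rewrite opprD addrA subrK.
  rewrite scalerBl -subDD !cancel [RHS](subDD (si - s0)) -opprD.
  by congr (_ - _); rewrite opprB addrA subrK.
apply: le_trans (ler_normD _ _) _; rewrite normrZ.
have : `|ti - tj| * `|v0| <= eta / 2.
  move: tij; rewrite ler_pdivlMr ?ltr_wpDl// => tij.
  by apply: le_trans tij; rewrite ler_wpM2l// lerDl.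
have := ler_normB (si - s0 - (wi + ti *: v0)) (sj - s0 - (wj + tj *: v0)).
by lra.
Qed.
End Subspace.

Section Linf.
Variables (R : realType) (n : nat).

Lemma norm_row_max (v : 'rV[R]_n) (j0 : 'I_n) :
  (forall j, `|v 0 j| <= `|v 0 j0|) -> `|v| = `|v 0 j0|.
Proof.
move=> vmax; rewrite [LHS]/Num.norm /= mx_normrE; apply/eqP; rewrite eq_le.
apply/andP; split; first by apply: bigmax_le => // -[i j] _; rewrite (ord1 i).
by apply/bigmax_geP; right => /=; exists (0, j0).
Qed.

Lemma sum_linf_basisE (a : 'I_n -> R) j :
  (\sum_(i < n) a i *: linf_basis R i) 0 j = a j.
Proof.
rewrite summxE (bigD1 j) //= !mxE !eqxx mulr1 big1 ?addr0// => i ij.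
by rewrite !mxE eqxx eq_sym (negPf ij) mulr0.
Qed.

Lemma linf_basis_normalized : normalized_basis (@linf_basis R n).
Proof.
split=> [i|v].
  rewrite (@norm_row_max _ i) => [|j]; rewrite !mxE !eqxx normr1 //.
  by case: (j == i); rewrite ?normr1 ?normr0.
exists (fun i => v 0 i); split=> [|a ->].
  by apply/rowP => j; rewrite sum_linf_basisE.
by apply/funext => i; rewrite sum_linf_basisE.
Qed.
End Linf.

Section Game.
Variables (R : realType) (X : normedModType R) (y : nat -> X) (D : R).
Hypothesis yD : forall l, `|y l| <= D.

(** The successive answers are perturbations of consecutive blocks of [y].  Given
    [Y], the next block is taken along a subsequence that is almost constant
    modulo [Y]; as the [c i] sum to 0, the block is close to [Y]. *)
Lemma asymptotic_game_linf n eps : (0 < n)%N -> 0 < eps ->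
  (forall delta, 0 < delta -> exists M (c : nat -> R) N,
    \sum_(i < M) c i = 0 /\ far_blocks_near_linf y n delta M c N) ->
  asymptotic_game n (fun s : seq X =>
      equivalent (1 + eps) (fun i : 'I_n => nth 0 s i) (@linf_basis R n)).
Proof.
move=> n0 eps0 near_linf.
(* [d] solves (1 + d) / (1 - d) = 1 + eps.  Each answer is at distance at most
   [3 delta] from its block, so that [d] collects [delta] and [n] such errors. *)
pose d := eps / (2 + eps); pose delta := d / (3 * n%:R + 1).
have n1 : 1 <= n%:R :> R by rewrite ler1n.
have e2 : 0 < 2 + eps by lra.
have d0 : 0 < d by rewrite divr_gt0.
have d1 : d < 1 by rewrite ltr_pdivrMr//; lra.
have delta0 : 0 < delta by rewrite divr_gt0//; lra.
have deltaE : delta * (3 * n%:R + 1) = d by rewrite divfK// gt_eqF//; lra.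
have delta4 : delta * 4 <= d.
  by rewrite -deltaE ler_pM2l//; lra.
have [M [c [N [c_sum cP]]]] := near_linf _ delta0.
pose S := \sum_(i < M) `|c i|.
have S0 : 0 <= S by exact: sumr_ge0.
pose eta := delta / (S + 1).
have eta0 : 0 < eta by rewrite divr_gt0// ltr_wpDl.
have Seta : S * eta <= delta.
  by rewrite /eta mulrA ler_pdivrMr ?ltr_wpDl// mulrC ler_pM2l// lerDl.
pose u (phi : nat -> nat) j := \sum_(i < M) c i *: y (phi (j * M + i)%N).
(* The state of the game after [r] rounds: the answers [s] follow the first [r]
   blocks along [phi]; the later values of [phi] are free. *)
pose inv r (s : seq X) (phi : nat -> nat) := [/\ size s = r, strict_incr phi,
  (forall i, N <= phi i)%N &
  forall j, (j < r)%N -> `|nth 0 s j - u phi j| <= 3 * delta].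
have norm_u phi j : strict_incr phi -> (forall i, N <= phi i)%N ->
    1 - delta <= `|u phi j| <= 1 + delta.
  move=> phiS phiN; pose b i : R := (i == 0%N)%:R.
  have := cP _ (strict_incr_comp phiS (@strict_incr_addl (j * M)%N))
    (fun i => phiN _) b 0%N n0.
  rewrite [b 0%N]/b eqxx normr1 !mulr1.
  have -> : \sum_(k < n) b k *:
      \sum_(i < M) c i *: y ((phi \o addn (j * M)) (k * M + i)%N) = u phi j.
    rewrite (bigD1 (Ordinal n0)) //= {1}/b eqxx scale1r [X in _ + X]big1.
      by rewrite addr0; apply: eq_bigr => i _; rewrite mul0n add0n.
    by move=> k; rewrite -val_eqE /b => /negPf ->; rewrite scale0r.
  by apply=> k _; rewrite /b; case: (k == 0%N); rewrite ?normr1 ?normr0.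
have fin s phi : inv n s phi ->
    equivalent (1 + eps) (fun i : 'I_n => nth 0 s i) (@linf_basis R n).
  move=> [_ phiS phiN sP]; exists (1 - d)^-1, (1 + d); split.
  - by rewrite invr_gt0; lra.
  - lra.
  - have d1' : 1 - d = 2 / (2 + eps) by rewrite /d; field; rewrite gt_eqF.
    have d1'' : 1 + d = (2 + 2 * eps) / (2 + eps) by rewrite /d; field; rewrite gt_eqF.
    rewrite d1' d1'' le_eqVlt; apply/orP; left; apply/eqP; field.
    by rewrite gt_eqF.
  move=> a; rewrite invrK.
  have [j0 _ jmax] : exists2 j0 : 'I_n, true & forall j, `|a j| <= `|a j0|.
    case: (@arg_maxP _ _ _ (Ordinal n0) xpredT (fun i => `|a i|)) => // j _ jm.
    by exists j => // i; exact: jm.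
  rewrite (@norm_row_max _ _ _ j0) ?sum_linf_basisE => [|j]; last first.
    by rewrite !sum_linf_basisE.
  pose b j : R := oapp a 0 (insub j).
  have bE (i : 'I_n) : b i = a i by rewrite /b valK.
  have := cP phi phiS phiN b j0 (ltn_ord j0).
  have bmax j : (j < n)%N -> `|b j| <= `|b j0|.
    by move=> jn; have := jmax (Ordinal jn); rewrite -!bE.
  move=> /(_ bmax); rewrite bE; under eq_bigr do rewrite bE.
  have : `|\sum_(j < n) a j *: nth 0 s j - \sum_(j < n) a j *: u phi j| <=
      3 * n%:R * delta * `|a j0|.
    rewrite -sumrB; under eq_bigr do rewrite -scalerBr.
    apply: le_trans (ler_norm_sum _ _ _) _.
    apply: le_trans (_ : \sum_(j < n) `|a j0| * (3 * delta) <= _).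
      by apply: ler_sum => j _; rewrite normrZ ler_pM// sP.
    by rewrite sumr_const card_ord -mulr_natl le_eqVlt; apply/orP; left; apply/eqP; ring.
  set x := \sum_(j < n) a j *: nth 0 s j; set w := \sum_(j < n) a j *: u phi j.
  move=> xw /andP[w1 w2].
  have := ler_normD (x - w) w; have := ler_normB x (x - w).
  rewrite subrK opprB addrC subrK => N1 N2.
  move: xw w1 w2; rewrite -deltaE; set A := `|a j0|.
  have -> : (1 - delta * (3 * n%:R + 1)) * A =
      (1 - delta) * A - 3 * n%:R * delta * A by ring.
  have -> : (1 + delta * (3 * n%:R + 1)) * A =
      (1 + delta) * A + 3 * n%:R * delta * A by ring.
  by move=> xw w1 w2; apply/andP; split; lra.
suff main m r s phi : (r + m)%N = n -> inv r s phi ->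
    asymptotic_game m (fun t : seq X =>
      equivalent (1 + eps) (fun i : 'I_n => nth 0 (s ++ t) i) (@linf_basis R n)).
  have := main n 0%N [::] (addn N) (add0n n); apply; split => //.
    exact: strict_incr_addl.
  by move=> i; exact: leq_addr.
elim: m r s phi => [|m IH] r s phi.
  by rewrite addn0 => -> /fin; rewrite /= cats0.
move=> rmn [sr phiS phiN sP] Y [YS _ Yfin].
have [psi psiS psiP] := almost_const_mod_subspace YS Yfin eta0 yD.
(* Keep the indices of the first [r] blocks and continue along [psi]. *)
pose phi' := splice (r * M) phi psi.
have phi'S : strict_incr phi' by exact: splice_incr.
have phi'N i : (N <= phi' i)%N.
  rewrite /phi' /splice; case: ifP => // _.
  apply: leq_trans (phiN (r * M)%N) _.
  by apply: leq_trans (leq_addr _ _) _; exact: strict_incr_ge.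
pose p := phi (r * M)%N.
have /choice[w wP] : forall i, exists z,
    Y z /\ `|y (psi (p + i)%N) - y (psi p) - z| <= eta.
  by move=> i; have [z Yz zP] := psiP (p + i)%N p; exists z.
pose W := \sum_(i < M) c i *: w i.
have YW : Y W := subspace_sum M c YS (fun i => (wP i).1).
have uW : `|u phi' r - W| <= delta.
  have -> : u phi' r - W =
      \sum_(i < M) c i *: (y (psi (p + i)%N) - y (psi p) - w i).
    under [RHS]eq_bigr do rewrite !scalerBr.
    rewrite !sumrB -[\sum_(i < M) c i *: y (psi p)]scaler_suml c_sum scale0r subr0.
    congr (_ - _); apply: eq_bigr => i _.
    by rewrite /phi' /splice ltnNge leq_addr /= addKn.
  apply: le_trans (ler_norm_sum _ _ _) _; apply: le_trans Seta.
  rewrite /S mulr_suml; apply: ler_sum => i _; rewrite normrZ ler_wpM2l//.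
  exact: (wP i).2.
have /andP[u1 u2] := norm_u phi' r phi'S phi'N.
have [W1 W2] : 1 - 2 * delta <= `|W| /\ `|W| <= 1 + 2 * delta.
  have := ler_normB (u phi' r) (u phi' r - W); rewrite opprB addrC subrK => h1.
  have := ler_normD (u phi' r - W) W; rewrite subrK => h2.
  by split; lra.
have W0 : 0 < `|W| by lra.
exists (`|W|^-1 *: W); split; first exact: subspaceZ.
  by rewrite normrZ gtr0_norm ?invr_gt0// mulVf// gt_eqF.
have inv' : inv r.+1 (rcons s (`|W|^-1 *: W)) phi'.
  split=> //; first by rewrite size_rcons sr.
  move=> j; rewrite ltnS leq_eqVlt => /orP[/eqP->|jr].
    rewrite nth_rcons sr ltnn eqxx.
    have -> : `|W|^-1 *: W - u phi' r = (`|W|^-1 - 1) *: W - (u phi' r - W).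
      by rewrite scalerBl scale1r opprB addrA subrK.
    apply: le_trans (ler_normB _ _) _; rewrite normrZ.
    suff : `| `|W|^-1 - 1| * `|W| <= 2 * delta by lra.
    rewrite -[X in _ * X](gtr0_norm W0) -normrM mulrBl mulVf ?gt_eqF// mul1r.
    by rewrite ler_norml; lra.
  have -> : u phi' j = u phi j.
    apply: eq_bigr => i _; rewrite /phi' /splice.
    have jM : (j.+1 * M <= r * M)%N by rewrite leq_mul2r jr orbT.
    have -> : (j * M + i < r * M)%N; last by [].
    by apply: leq_trans jM; rewrite mulSnr ltn_add2l.
  by rewrite nth_rcons sr jr sP.
have := IH r.+1 _ _ _ inv'; rewrite addSnnS => /(_ rmn).
by under [in X in X -> _]eq_fun => t do rewrite cat_rcons.
Qed.
End Game.

(** * Embedding of bundle graphs *)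

(** The increasing enumeration of [s], continued beyond all elements of [s]. *)
Lemma seq_enum_incr (s : seq nat) : uniq s ->
  exists2 J, strict_incr J & perm_eq [seq J i | i <- iota 0 (size s)] s.
Proof.
move=> us; pose s' := sort leq s.
have s's : perm_eq s' s by rewrite perm_sort.
have srt : sorted ltn s'.
  by rewrite ltn_sorted_uniq_leq sort_uniq us sort_sorted//; exact: leq_total.
have ss : size s' = size s by rewrite size_sort.
exists (fun i => if (i < size s)%N then nth 0%N s' i else (sumn s' + i).+1).
  move=> i j ij; case: (ltnP i _) => im; case: (ltnP j _) => jm; try lia.
    by apply: (sorted_ltn_nth ltn_trans); rewrite ?inE ?ss.
  suff : (nth 0%N s' i <= sumn s')%N by lia.
  have le_sumn (t : seq nat) a : a \in t -> (a <= sumn t)%N.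
    by elim: t => //= a' t IH; rewrite inE => /orP[/eqP->|/IH]; lia.
  by apply: le_sumn; rewrite mem_nth// ss.
apply: perm_trans s's; rewrite -[X in perm_eq _ X](mkseq_nth 0%N) /mkseq ss.
set f := map _ _; set g := map _ _.
suff -> : f = g by exact: perm_refl.
apply/eq_in_map => i; rewrite mem_iota /= => ->.
by [].
Qed.

Lemma seq_argmax (R : realDomainType) (T : eqType) (s : seq T) (b : T -> R) :
  s != [::] -> exists2 j0, j0 \in s & forall j, j \in s -> b j <= b j0.
Proof.
elim: s => // a s IH _; have [->|/IH[j0 j0s j0P]] := eqVneq s [::].
  by exists a; rewrite ?mem_seq1 // => j; rewrite mem_seq1 => /eqP ->.
have [ab|ba] := leP (b a) (b j0).
  by exists j0; rewrite ?inE ?j0s ?orbT// => j; rewrite inE => /orP[/eqP->|/j0P].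
exists a; rewrite ?inE ?eqxx// => j; rewrite inE => /orP[/eqP->//|/j0P jj0].
exact: le_trans jj0 (ltW ba).
Qed.

(** Blocks of consecutive terms of [y], with disjoint ranges.  Any [n] of them, in
    increasing order, are blocks along an increasing sequence of indices; fewer
    than [n] are completed by blocks with coefficient 0. *)
Lemma near_linf_family (R : realType) (X : normedModType R) (y : nat -> X)
    M (c : nat -> R) N n (delta : R) :
  far_blocks_near_linf y n delta M c N ->
  let u j := \sum_(i < M) c i *: y (N + (j * M + i))%N in
  forall (s : seq nat) (b : nat -> R) j0, uniq s -> (size s <= n)%N ->
    j0 \in s -> (forall j, j \in s -> `|b j| <= `|b j0|) ->
    (1 - delta) * `|b j0| <= `|\sum_(j <- s) b j *: u j| <= (1 + delta) * `|b j0|.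
Proof.
move=> near_linf u s b j0 us sn j0s bmax.
have [J JS Js] := seq_enum_incr us.
pose phi l := (N + (J (l %/ M) * M + l %% M))%N.
have phiS : strict_incr phi.
  move=> l l' ll'; rewrite /phi ltn_add2l.
  have [->|M0] := posnP M; first by rewrite !muln0 !modn0.
  have := ltn_pmod l M0; have := ltn_pmod l' M0; have := divn_eq l M.
  have := divn_eq l' M; have := leq_div2r M (ltnW ll').
  rewrite leq_eqVlt => /orP[/eqP->|/JS JJ] El' El; first lia.
  have : ((J (l %/ M)).+1 * M <= J (l' %/ M) * M)%N by rewrite leq_mul2r JJ orbT.
  by rewrite mulSnr; lia.
pose b' i := if (i < size s)%N then b (J i) else 0.
have JsE j : (j \in s) = (j \in [seq J i | i <- iota 0 (size s)]).
  by rewrite (perm_mem Js).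
have JP i : (i < size s)%N -> J i \in s.
  by move=> i_s; rewrite JsE map_f// mem_iota.
have [i0 i0s j0E] : exists2 i0, (i0 < size s)%N & j0 = J i0.
  by move: j0s; rewrite JsE => /mapP[i0]; rewrite mem_iota => ? ->; exists i0.
have b'0 : b' i0 = b j0 by rewrite /b' i0s j0E.
have := near_linf phi phiS (fun i => leq_addr _ _) b' i0 (leq_trans i0s sn).
rewrite b'0 => /(_ _)/= H.
have {H} : (1 - delta) * `|b j0| <= `|\sum_(j < n) b' j *: u (J j)| <=
    (1 + delta) * `|b j0|.
  rewrite (_ : \sum_(j < n) _ = \sum_(j < n) b' j *:
      \sum_(i < M) c i *: y (phi (j * M + i)%N)).
    apply: H => j _; rewrite /b'; case: ifP => [j_s|_]; last by rewrite normr0.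
    exact/bmax/JP.
  apply: eq_bigr => j _; congr (_ *: _); apply: eq_bigr => i _.
  have M0 : (0 < M)%N by apply: leq_ltn_trans (ltn_ord i).
  by rewrite /phi divnMDl// divn_small// addn0 modnMDl modn_small.
suff -> : \sum_(j <- s) b j *: u j = \sum_(j < n) b' j *: u (J j) by [].
rewrite -(perm_big _ Js) /= big_map.
rewrite -(big_mkord xpredT (fun j => b' j *: u (J j))) (big_cat_nat (leq0n _) sn)//=.
rewrite [X in _ + X]big1_seq ?addr0 => [|i]; last first.
  rewrite mem_index_iota => /andP[_ /andP[si _]].
  by rewrite /b' ltnNge si scale0r.
rewrite /index_iota subn0 big_seq [RHS]big_seq; apply: eq_bigr => i.
by rewrite mem_iota /b' /= => ->.
Qed.

Lemma ndistE (R : realDomainType) a b : (ndist a b)%:R = `|a%:R - b%:R| :> R.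
Proof.
rewrite /ndist; case: (leqP a b) => ab.
  rewrite (eqP ab) add0n natrB// distrC ger0_norm//.
  by rewrite subr_ge0 ler_nat.
have ba := ltnW ab.
by rewrite (eqP ba) addn0 natrB// ger0_norm// subr_ge0 ler_nat.
Qed.

Section Coordinates.
Variables (G : tbgraph) (c : graph_coords G).

(** [level] and the coordinates on a common index set [nat]; [pickle_inv] leaves
    coordinate 0 at the numbers that encode no index. *)
Definition ncoord (x : G) (j : nat) : nat :=
  if j is i.+1 then oapp (@coordinate _ c x) 0%N (pickle_inv i) else level c x.

Lemma ncoord_lip x y j m : walk m x y ->
  (ndist (ncoord x j) (ncoord y j) <= m)%N.
Proof.
case: j => [|j] /=; first exact/walk_lip/level_adj.
case: (pickle_inv j) => [i|] /=; last by rewrite /ndist subnn.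
by apply: (@walk_lip _ (fun x => coordinate x i)) => x' y'; exact: coord_adj.
Qed.

Lemma ncoord_supp x : exists s : seq nat,
  [/\ uniq s, (size s <= (supp c).+1)%N, 0%N \in s &
      forall j, j \notin s -> ncoord x j = 0%N].
Proof.
have [s ss s0] := coord_supp c x.
exists (undup (0%N :: [seq (pickle i).+1 | i <- s])); split.
- exact: undup_uniq.
- by apply: leq_trans (size_undup _) _; rewrite /= size_map.
- by rewrite mem_undup inE eqxx.
move=> [|j]; rewrite mem_undup inE ?eqxx//= => js.
have := @pickle_invK (cidx c) j; case: pickle_inv => //= i ij.
apply: s0; apply: contra js => i_s.
by apply/mapP; exists i; rewrite ?ij.
Qed.

Lemma ncoord_walk x y : exists2 m, walk m x y &
  exists j, (m <= 3 * ndist (ncoord x j) (ncoord y j))%N.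
Proof.
have [m xy [mP|[i mP]]] := coord_walk c x y; exists m => //; first by exists 0%N.
by exists (pickle i).+1; rewrite /= pickleK_inv.
Qed.
End Coordinates.

Lemma sum_supp (V : nmodType) (s t : seq nat) (F : nat -> V) :
  uniq s -> uniq t -> {subset s <= t} -> (forall j, j \notin s -> F j = 0) ->
  \sum_(j <- s) F j = \sum_(j <- t) F j.
Proof.
move=> us ut st F0; rewrite [RHS](bigID (mem s)) /= addrC [X in _ = X + _]big1 ?add0r//.
rewrite -[RHS]big_filter; apply: perm_big; apply: uniq_perm => //.
  exact: filter_uniq.
by move=> j; rewrite mem_filter; case: (boolP (j \in s)) => // /st ->.
Qed.

(** The image of a point is the combination of the [u j] with its coordinates.  Two
    points have together at most [2 (supp + 1)] nonzero coordinates, so the norm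
    of the difference of their images is, up to the factors 3/4 and 5/4, the
    largest difference of the coordinates, which is between [d / 3] and [d]. *)
Lemma coords_embedding (R : realType) (X : normedModType R) (G : tbgraph)
    (c : graph_coords G) (u : nat -> X) :
  (forall (s : seq nat) (b : nat -> R) j0, uniq s ->
    (size s <= 2 * (supp c).+1)%N ->
    j0 \in s -> (forall j, j \in s -> `|b j| <= `|b j0|) ->
    (1 - 4^-1) * `|b j0| <= `|\sum_(j <- s) b j *: u j| <= (1 + 4^-1) * `|b j0|) ->
  exists f : G -> X, distortion_at_most f 5.
Proof.
move=> near_linf.
have /choice[s sP] := ncoord_supp c.
exists (fun x => \sum_(j <- s x) (ncoord c x j)%:R *: u j).
exists 4^-1; first by rewrite invr_gt0.
move=> x y.
have [xs xsz x0 xN] := sP x; have [ys ysz y0 yN] := sP y.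
pose t := undup (s x ++ s y).
have tE j : (j \in t) = (j \in s x) || (j \in s y).
  by rewrite mem_undup mem_cat.
have tu : uniq t by exact: undup_uniq.
have tsz : (size t <= 2 * (supp c).+1)%N.
  by apply: leq_trans (size_undup _) _; rewrite size_cat mul2n -addnn leq_add.
pose b j : R := (ncoord c x j)%:R - (ncoord c y j)%:R.
have -> : \sum_(j <- s x) (ncoord c x j)%:R *: u j -
    \sum_(j <- s y) (ncoord c y j)%:R *: u j = \sum_(j <- t) b j *: u j.
  rewrite (sum_supp xs tu); first last.
  - by move=> j /xN ->; rewrite scale0r.
  - by move=> j jx; rewrite tE jx.
  rewrite (sum_supp ys tu); first last.
  - by move=> j /yN ->; rewrite scale0r.
  - by move=> j jy; rewrite tE jy orbT.
  by rewrite -sumrB; apply: eq_bigr => j _; rewrite scalerBl.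
have t0 : t != [::].
  by apply/eqP => t0; have := tE 0%N; rewrite t0 x0.
have [j0 j0t bmax] := seq_argmax (fun j => `|b j|) t0.
have [m xy [j mP]] := ncoord_walk c x y.
have [dxy dm] := graph_distP xy.
have d_le : (graph_dist x y)%:R <= 3 * `|b j0|.
  have h : (graph_dist x y)%:R <= 3 * `|b j|.
    by rewrite -ndistE -natrM ler_nat (leq_trans dm).
  apply: le_trans h _; rewrite ler_pM2l//.
  have [/bmax//|] := boolP (j \in t); rewrite tE negb_or => /andP[/xN xj /yN yj].
  by rewrite {1}/b xj yj subrr normr0.
have le_d : `|b j0| <= (graph_dist x y)%:R.
  by rewrite -ndistE ler_nat; exact: ncoord_lip.
have /andP[lo hi] := near_linf t b j0 tu tsz j0t bmax.
by apply/andP; split; lra.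
Qed.

Theorem mainTheorem10 (R : realType) (X : completeNormedModType R)
    (hX : has_c0_spreading_model X) :
  (forall n : nat, (1 <= n)%N ->
     in_asymptotic_structure X (@linf_basis R n)) /\
  (forall eps : R, 0 < eps ->
     forall G : tbgraph, nontrivial_bundle_graph G ->
       exists (f : G -> X) (D : R), D < 6 + eps /\ distortion_at_most f D).
Proof.
have [y [Z [e [ye Z_c0]]]] := hX.
have spreadP := spreading_model_spreads ye.
have [D yD] := spreading_model_bounded ye.
have e01 := spreading_model_neq ye.
split=> [n n0|eps eps0 G /bundle_coords[c]].
  split=> [|eps eps0]; first exact: linf_basis_normalized.
  apply: (asymptotic_game_linf yD) => // delta delta0.
  exact: (near_linf_sequence spreadP Z_c0 e01 n delta0 yD).
have d0 : 0 < 4^-1 :> R by rewrite invr_gt0.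
have [M [a [N [_ aP]]]] := near_linf_sequence spreadP Z_c0 e01 (2 * (supp c).+1) d0 yD.
have [f f5] := coords_embedding (near_linf_family aP).
by exists f, 5; split => //; lra.
Qed.
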